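(* Let $(p_n)_{n\ge 0}$ be the polynomials determined by $p_0(x)=1$ and $xp_n(x)=\gamma_np_{n+1}(x)+\alpha_np_{n-1}(x)$ for $n\ge 0$, where $\alpha_0=0$, $\gamma_0=1$, and $\alpha_n>0$, $\gamma_n>0$, $\alpha_n+\gamma_n=1$ for $n\ge 1$. Assume that $(\alpha_n)_{n\ge0}$ is increasing, $\alpha_n\le 1/2$ for all $n$, and $$\alpha_n-\alpha_{n-1}\ge \frac{\alpha_n}{1-\alpha_n}(\alpha_{n+1}-\alpha_n),\quad n\ge 1$$ (this last condition is satisfied, e.g., if $(\alpha_n)$ is concave). Then $\Delta_n(x)=p_n^2(x)-p_{n-1}(x)p_{n+1}(x)$ satisfies $$\frac{\Delta_n(x)}{1-x^2}\ge c\,\Delta_n(0),\qquad -1<x<1,\ n\ge 1,$$ where $c=2\alpha_1\gamma_2/\gamma_1$.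
   Context: ''Increasing'' is meant in the weak sense ($\alpha_n\le\alpha_{n+1}$). A sequence $(\alpha_n)_{n\ge0}$ is concave if $\alpha_{n+1}-\alpha_n\le\alpha_n-\alpha_{n-1}$ for $n\ge1$. *)

(* Defs.v *)
From HB Require Import structures.
From mathcomp Require Import all_boot all_order all_algebra.
From mathcomp Require Import reals.
Set Implicit Arguments.
Unset Strict Implicit.
Unset Printing Implicit Defensive.
Import Order.TTheory GRing.Theory Num.Theory.
Local Open Scope ring_scope.

Definition increasing_seq (R : realType) (a : nat -> R) : Prop :=
  forall n : nat, a n <= a n.+1.

Definition concave_seq (R : realType) (a : nat -> R) : Prop :=
  forall n : nat, (1 <= n)%N -> a n.+1 - a n <= a n - a n.-1.

(* [n.-1] is [0] for [n = 0]; the choice made there for p_{-1} is irrelevant,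
   since its coefficient [alpha 0] is [0] wherever this is used. *)
Definition three_term_rec (R : realType) (alpha gamma : nat -> R)
    (p : nat -> {poly R}) : Prop :=
  p 0%N = 1 /\
  forall n : nat, 'X * p n = gamma n *: p n.+1 + alpha n *: p n.-1.

(* The Turan determinant, meaningful only for [1 <= n]. *)
Definition turan_det (R : realType) (p : nat -> {poly R}) (n : nat) : {poly R} :=
  p n ^+ 2 - p n.-1 * p n.+1.

(* Main.v *)
Require Import Defs.
From HB Require Import structures.
From mathcomp Require Import all_boot all_order all_algebra.
From mathcomp Require Import reals.
From mathcomp Require Import ring lra.
Import Order.TTheory GRing.Theory Num.Theory.
Local Open Scope ring_scope.

(* Write b_n = alpha_n / gamma_n and k_n = b_1 ... b_n.  The quotients
   s_n = (p_n - x p_(n+1)) / (1 - x^2) and t_n = (x p_n - p_(n+1)) / (1 - x^2)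
   satisfy t_(n+1) = b_(n+1) s_n and gamma_(n+1) (s_(n+1) + t_n) = x s_n, so
   that the s_n are the orthogonal polynomials for the measure of the p_n
   multiplied by 1 - x^2; moreover
     Delta_(n+1) / (1 - x^2) = s_n t_(n+1) - s_(n+1) t_n.
   The growth condition says that alpha_n gamma_(n+1) increases.  These are the
   squared off-diagonal Jacobi coefficients of the s_n, and their monotonicity
   makes T_n / k_n increase, where
     T_n = gamma_(n+2) s_n t_(n+1) - gamma_(n+1) s_(n+1) t_n
         <= gamma_(n+1) Delta_(n+1) / (1 - x^2).
   Hence T_n >= k_n T_0 = k_n gamma_2 b_1.  At x = 0 a similar recursion gives
   Delta_(n+1)(0) <= b_(n+1) k_n, and 2 alpha_(n+1) <= 1 concludes. *)

Lemma concave_growth_cond (R : realType) (a : nat -> R) (n : nat) :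
  increasing_seq a -> concave_seq a -> (1 <= n)%N -> 0 <= a n <= 1 / 2 ->
  a n / (1 - a n) * (a n.+1 - a n) <= a n - a n.-1.
Proof.
move=> a_incr a_conc n_gt0 /andP[an_ge0 an_le].
apply: le_trans (a_conc n n_gt0); apply: ler_piMl.
  by rewrite subr_ge0 a_incr.
by rewrite ler_pdivrMr; lra.
Qed.

(** For consecutive values [a], [b], [c] of [alpha], clearing [1 - b] cancels the terms in b^2. *)
Lemma growth_cond_homo (R : realFieldType) (a b c : R) :
  b < 1 -> b / (1 - b) * (c - b) <= b - a -> a * (1 - b) <= b * (1 - c).
Proof.
move=> b_lt1; rewrite mulrAC ler_pdivrMr; last lra.
by move=> h; nra.
Qed.

(** The matrix taking (p_m, p_(m+1)) to (s_m, t_m) does not depend on m and has determinant -1 /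
    w. *)
Lemma turan_det_wronskian (R : realType) (p : nat -> {poly R}) (n : nat) (x : R)
    (w := 1 - x ^+ 2)
    (s := fun m => ((p m).[x] - x * (p m.+1).[x]) / w)
    (t := fun m => (x * (p m).[x] - (p m.+1).[x]) / w) :
  w != 0 ->
  (turan_det p n.+1).[x] / w = s n * t n.+1 - s n.+1 * t n.
Proof.
move=> w_neq0; rewrite /turan_det !hornerE /s /t /= /w; field.
exact: w_neq0.
Qed.

(* The argument [g] stands for [gamma], [b] for [alpha / gamma]. *)
Definition jacobi_pair {R : realType} (b g : nat -> R) (x : R)
    (s t : nat -> R) : Prop :=
  [/\ s 0%N = 1, t 0%N = 0, forall n, t n.+1 = b n.+1 * s n
    & forall n, g n.+1 * (s n.+1 + t n) = x * s n].

(** As alpha + gamma = 1, both gamma_(n+1) (p_n - p_(n+2)) and gamma_(n+1) (x p_(n+1) - p_(n+2)) are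
    multiples of p_n - x p_(n+1), with factors 1 and alpha_(n+1). *)
Lemma three_term_rec_jacobi_pair (R : realType) (alpha gamma : nat -> R)
    (p : nat -> {poly R}) (x : R) (w := 1 - x ^+ 2) :
  alpha 0%N = 0 -> gamma 0%N = 1 ->
  (forall n, gamma n.+1 != 0) -> (forall n, alpha n.+1 = 1 - gamma n.+1) ->
  three_term_rec alpha gamma p -> w != 0 ->
  jacobi_pair (fun n => alpha n / gamma n) gamma x
    (fun n => ((p n).[x] - x * (p n.+1).[x]) / w)
    (fun n => (x * (p n).[x] - (p n.+1).[x]) / w).
Proof.
move=> a0 g0 g_neq0 aE [p0 p_rec] w_neq0.
have p1 : p 1%N = 'X.
  by have := p_rec 0%N; rewrite a0 g0 p0 scale0r scale1r addr0 mulr1.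
have pS n : (p n.+2).[x] =
    (x * (p n.+1).[x] - alpha n.+1 * (p n).[x]) / gamma n.+1.
  have := congr1 (horner^~ x) (p_rec n.+1); rewrite !hornerE /= => ->.
  by field; exact: g_neq0.
split=> [||n|n].
- by rewrite p0 p1 !hornerE -expr2 divff.
- by rewrite p0 p1 !hornerE subrr mul0r.
- by rewrite pS aE /w; field; rewrite g_neq0 w_neq0.
- by rewrite pS aE /w; field; rewrite g_neq0 w_neq0.
Qed.

Lemma jacobi_pair_lower_bound (R : realType) (b g : nat -> R) (x : R)
    (s t : nat -> R) (n : nat) :
  jacobi_pair b g x s t -> (forall m, 0 <= b m.+1) ->
  (forall m, b m.+1 * g m.+1 <= b m.+2 * g m.+3) ->
  (\prod_(j < n) b j.+1) * (g 2%N * b 1%N) <=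
    g n.+2 * (s n * t n.+1) - g n.+1 * (s n.+1 * t n).
Proof.
move=> [s0 t0 tS sS] b_ge0 bg_homo; elim: n => [|n IHn].
  by rewrite big_ord0 t0 tS s0; lra.
rewrite big_ord_recr /= mulrAC.
apply: le_trans (ler_wpM2r (b_ge0 n) IHn) _.
have sSn := sS n; have sSn1 := sS n.+1; have tSn := tS n; have tSn1 := tS n.+1.
rewrite -subr_ge0.
(* In T_(n+1) - b_(n+1) T_n the terms in s_n s_(n+1) and s_n^2 cancel. *)
have -> : g n.+3 * (s n.+1 * t n.+2) - g n.+2 * (s n.+2 * t n.+1) -
    (g n.+2 * (s n * t n.+1) - g n.+1 * (s n.+1 * t n)) * b n.+1 =
    (b n.+2 * g n.+3 - b n.+1 * g n.+1) * s n.+1 ^+ 2.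
  have -> : g n.+2 * (s n.+2 * t n.+1) =
      (x * s n.+1 - g n.+2 * t n.+1) * t n.+1 by rewrite -sSn1; ring.
  have -> : g n.+1 * (s n.+1 * t n) =
      s n.+1 * (x * s n - g n.+1 * s n.+1) by rewrite -sSn; ring.
  by rewrite tSn tSn1; ring.
by rewrite mulr_ge0 ?sqr_ge0 // subr_ge0.
Qed.

(** At x = 0, s_(m+1) = - t_m, so the left side is D_n = b_(n+1) s_n^2 + t_n^2, and increasing b
    gives D_(n+1) <= b_(n+2) D_n. *)
Lemma jacobi_pair0_upper_bound (R : realType) (b g : nat -> R)
    (s t : nat -> R) (n : nat) :
  jacobi_pair b g 0 s t -> (forall m, g m.+1 != 0) ->
  (forall m, 0 <= b m.+1) -> (forall m, b m.+1 <= b m.+2) ->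
  s n * t n.+1 - s n.+1 * t n <= b n.+1 * \prod_(j < n) b j.+1.
Proof.
move=> [s0 t0 tS sS] g_neq0 b_ge0 b_homo.
have sSN m : s m.+1 = - t m.
  by apply/eqP; rewrite -addr_eq0 -(mulrI_eq0 _ (lregP (g_neq0 m))) sS mul0r.
elim: n => [|n IHn]; first by rewrite big_ord0 tS t0 s0; lra.
rewrite big_ord_recr /= [X in b n.+2 * X]mulrC.
apply: le_trans (ler_wpM2l (b_ge0 n.+1) IHn).
rewrite !sSN !tS sSN -subr_ge0.
have -> : b n.+2 * (s n * (b n.+1 * s n) - - t n * t n) -
    (- t n * (b n.+2 * - t n) - - (b n.+1 * s n) * (b n.+1 * s n)) =
    (b n.+2 - b n.+1) * (b n.+1 * s n ^+ 2) by ring.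
by apply: mulr_ge0; rewrite ?subr_ge0 // mulr_ge0 ?sqr_ge0.
Qed.

Theorem theorem2p5 (R : realType) (alpha gamma : nat -> R) (p : nat -> {poly R})
  (alpha0 : alpha 0%N = 0) (gamma0 : gamma 0%N = 1)
  (alpha_gt0 : forall n : nat, (1 <= n)%N -> 0 < alpha n)
  (gamma_gt0 : forall n : nat, (1 <= n)%N -> 0 < gamma n)
  (alphaDgamma : forall n : nat, (1 <= n)%N -> alpha n + gamma n = 1)
  (p_rec : three_term_rec alpha gamma p)
  (alpha_incr : increasing_seq alpha)
  (alpha_le_half : forall n : nat, alpha n <= 1 / 2) :
  let growth_cond : Prop :=
    forall n : nat, (1 <= n)%N ->
      alpha n - alpha n.-1 >= alpha n / (1 - alpha n) * (alpha n.+1 - alpha n) in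
  let c : R := 2 * alpha 1%N * gamma 2%N / gamma 1%N in
  (concave_seq alpha -> growth_cond) /\
  (growth_cond ->
   forall (n : nat) (x : R), (1 <= n)%N -> -1 < x < 1 ->
     (turan_det p n).[x] / (1 - x ^+ 2) >= c * (turan_det p n).[0]).
Proof.
move=> growth_cond c; split=> [a_conc n n_gt0|growth [//|n] x _ /andP[x_gtN1 x_lt1]].
  by apply: concave_growth_cond => //; rewrite ltW ?alpha_gt0 //=.
have aE m : alpha m.+1 = 1 - gamma m.+1 by have := alphaDgamma m.+1 isT; lra.
have g_gt0 m : 0 < gamma m.+1 by exact: gamma_gt0.
have g_neq0 m : gamma m.+1 != 0 by rewrite gt_eqF.
have g_homo m : gamma m.+2 <= gamma m.+1.
  by have := alpha_incr m.+1; rewrite !aE; lra.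
pose b m := alpha m / gamma m.
have b_ge0 m : 0 <= b m.+1 by rewrite divr_ge0 ?ltW ?alpha_gt0.
have b_homo m : b m.+1 <= b m.+2.
  by rewrite ler_pM ?invr_ge0 ?lef_pV2 ?posrE // ltW ?alpha_gt0.
have bgE m : b m.+1 * gamma m.+1 = alpha m.+1 by rewrite divfK.
have bg_homo m : b m.+1 * gamma m.+1 <= b m.+2 * gamma m.+3.
  (* Times [gamma m.+2], this is the growth condition at [m.+2]. *)
  rewrite bgE mulrAC ler_pdivlMr //.
  have a_lt1 : alpha m.+2 < 1 by have := alpha_le_half m.+2; lra.
  by have := growth_cond_homo _ _ _ _ a_lt1 (growth m.+2 isT); rewrite !aE !subKr.
pose s y m := ((p m).[y] - y * (p m.+1).[y]) / (1 - y ^+ 2).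
pose t y m := (y * (p m).[y] - (p m.+1).[y]) / (1 - y ^+ 2).
have jacobi y : 1 - y ^+ 2 != 0 -> jacobi_pair b gamma y (s y) (t y).
  by move=> ?; exact: three_term_rec_jacobi_pair.
have w_neq0 : 1 - x ^+ 2 != 0 by rewrite gt_eqF //; nra.
have w0 : 1 - 0 ^+ 2 = 1 :> R by rewrite expr0n subr0.
have w0_neq0 : 1 - 0 ^+ 2 != 0 :> R by rewrite w0 oner_eq0.
have lower := jacobi_pair_lower_bound _ _ _ _ _ _ n (jacobi x w_neq0) b_ge0 bg_homo.
have := jacobi_pair0_upper_bound _ _ _ _ _ n (jacobi 0 w0_neq0) g_neq0 b_ge0 b_homo.
rewrite -turan_det_wronskian // w0 divr1 => upper.
rewrite turan_det_wronskian // -/(s x n) -/(t x n.+1) -/(s x n.+1) -/(t x n).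
have st_ge0 : 0 <= s x n * t x n.+1.
  have [_ _ -> _] := jacobi x w_neq0.
  by rewrite mulrCA mulr_ge0 // -expr2 sqr_ge0.
set K := \prod_(j < n) b j.+1 in lower upper.
have K_ge0 : 0 <= K by exact: prodr_ge0.
have cE : c = 2 * (gamma 2%N * b 1%N) by rewrite /c /b; ring.
have gb_ge0 : 0 <= gamma 2%N * b 1%N by rewrite mulr_ge0 // ltW.
have c_ge0 : 0 <= c by rewrite cE mulr_ge0.
apply: le_trans (ler_wpM2l c_ge0 upper) _.
(* The factor [gamma n.+1] turns [b n.+1] into [alpha n.+1], which absorbs the 2 in [c]. *)
rewrite -(ler_pM2l (g_gt0 n)).
have -> : gamma n.+1 * (c * (b n.+1 * K)) =
    2 * alpha n.+1 * (K * (gamma 2%N * b 1%N)) by rewrite cE -bgE; ring.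
have two_alpha_le1 : 2 * alpha n.+1 <= 1 by have := alpha_le_half n.+1; lra.
apply: le_trans (ler_piMl _ two_alpha_le1) _; first exact: mulr_ge0.
(* What remains is [g_homo] times s_n t_(n+1) >= 0. *)
apply: le_trans lower _; rewrite mulrBr lerD2r.
exact: ler_wpM2r.
Qed.
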